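(* Let $\lambda,\mu,\delta>0$ and let $b>-1$ satisfy $(1+b)e^{-\mu\delta}<1$. Consider the linear impulsive differential equation $$\frac{dq}{dt}(t)=\lambda-\mu q(t)\quad (t\neq t_k),\qquad q(t_k^+)-q(t_k^-)=b\,q(t_k^-),\qquad t_k=k\delta,\ k\in\mathbb{N}.$$ Then the average queue length $\mathcal{A}$ during a time interval of length $\delta$ between consecutive impulses in steady state is $$\mathcal{A}=\frac{\lambda}{\mu}+\left(\frac{\lambda(1+b)}{\mu^2\delta}\left(\frac{1-e^{-\mu\delta}}{1-(1+b)e^{-\mu\delta}}\right)-\frac{\lambda}{\mu^2\delta}\right)\left(1-e^{-\mu\delta}\right).$$
   Context: $q(t_k^-)$ and $q(t_k^+)$ denote the left and right limits of $q$ at $t_k$. The steady state is the $\delta$-periodic solution of the impulsive equation. The average queue length over one inter-impulse interval in steady state is $\mathcal{A}=\frac1\delta\int_0^\delta q(s)\,ds$, where time $0$ is taken immediately after an impulse, so that $q(0)$ is the steady-state post-impulse value and $q$ solves $\frac{dq}{dt}=\lambda-\mu q$ on $(0,\delta)$. *)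

(* Defs.v *)
From Stdlib Require Import Reals.
From Coquelicot Require Import Coquelicot.
Local Open Scope R_scope.

Definition impulse_time (delta : R) (k : nat) : R := INR k * delta.

(* Solutions live on [0, +oo), where time 0 is immediately after an impulse:
   the impulse at t_0 = 0 has already taken place, so jumps are imposed at t_k
   for k >= 1, and values of q at negative times are irrelevant.  The value of q
   at an impulse time is the post-impulse one (right-continuity); in particular
   q 0 is the post-impulse value q(0^+). *)
Record impulsive_solution (lambda mu delta b : R) (q : R -> R) : Prop := {
  solution_ode : forall t : R, 0 < t ->
    (forall k : nat, t <> impulse_time delta k) ->
    is_derive q t (lambda - mu * q t);
  solution_post_impulse : forall k : nat,
    filterlim q (at_right (impulse_time delta k))
      (locally (q (impulse_time delta k)));
  solution_jump : forall k : nat, (1 <= k)%nat ->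
    exists qminus qplus : R,
      filterlim q (at_left (impulse_time delta k)) (locally qminus) /\
      filterlim q (at_right (impulse_time delta k)) (locally qplus) /\
      qplus - qminus = b * qminus
}.

Definition steady_state (lambda mu delta b : R) (q : R -> R) : Prop :=
  impulsive_solution lambda mu delta b q /\
  (forall t : R, 0 <= t -> q (t + delta) = q t).

Definition average_queue_length (delta : R) (q : R -> R) : R :=
  / delta * RInt q 0 delta.

(* Main.v *)
Require Import Defs.
From Stdlib Require Import Reals Lra Lia.
From Coquelicot Require Import Coquelicot.
Local Open Scope R_scope.

(** Between impulses the solutions of the linear equation are the relaxations
    [lambda/mu + c e^(-mu t)].  Periodicity together with the jump condition at
    [delta] reads [lambda/mu + c = (1+b)(lambda/mu + c e^(-mu delta))], which by
    stability has exactly one solution [c]; hence the steady state exists, is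
    unique, and its average is an elementary integral. *)

Definition relaxation (lambda mu c t : R) : R :=
  lambda / mu + c * exp (- (mu * t)).

(** The root [c] of the jump equation at [delta]: the deviation of the post-impulse value from the
    equilibrium [lambda / mu]. *)
Definition steady_amplitude (lambda mu delta b : R) : R :=
  b * lambda / (mu * (1 - (1 + b) * exp (- (mu * delta)))).

(** [Int_part] is the floor, so each period is closed on the left: at an impulse time the value is
    [f 0], the post-impulse one. *)
Definition periodic_extension (delta : R) (f : R -> R) (t : R) : R :=
  f (t - IZR (Int_part (t / delta)) * delta).

Lemma is_derive_relaxation (lambda mu c t0 t : R) : mu <> 0 ->
  is_derive (fun s => relaxation lambda mu c (s - t0)) t
    (lambda - mu * relaxation lambda mu c (t - t0)).
Proof.
  intros Hmu. unfold relaxation. auto_derive; trivial.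
  unfold Rminus. field. exact Hmu.
Qed.

(** Continuity, with [F] left general so that it serves for both one-sided limits at an impulse
    time. *)
Lemma filterlim_relaxation (lambda mu c t0 t : R) (F : (R -> Prop) -> Prop) :
  mu <> 0 -> filter_le F (locally t) ->
  filterlim (fun s => relaxation lambda mu c (s - t0)) F
    (locally (relaxation lambda mu c (t - t0))).
Proof.
  intros Hmu HF. apply (filterlim_filter_le_1 _ HF).
  apply (ex_derive_continuous (fun s => relaxation lambda mu c (s - t0))).
  eexists. apply is_derive_relaxation. exact Hmu.
Qed.

Lemma at_right_interval (x y : R) : x < y -> at_right x (fun t => x < t < y).
Proof.
  intros Hxy. assert (Hd : 0 < y - x) by lra.
  exists (mkposreal _ Hd). intros t Ht Hlt.
  apply Rabs_lt_between in Ht. unfold minus, plus, opp in Ht. simpl in Ht. lra.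
Qed.

Lemma at_left_interval (x y : R) : x < y -> at_left y (fun t => x < t < y).
Proof.
  intros Hxy. assert (Hd : 0 < y - x) by lra.
  exists (mkposreal _ Hd). intros t Ht Hlt.
  apply Rabs_lt_between in Ht. unfold minus, plus, opp in Ht. simpl in Ht. lra.
Qed.

Lemma zero_derivative_constant (g : R -> R) (a b : R) :
  (forall t, a < t < b -> is_derive g t 0) ->
  forall x y, a < x < b -> a < y < b -> g x = g y.
Proof.
  intros Hg x y Hx Hy.
  assert (Hin : forall t, Rmin x y <= t <= Rmax x y -> a < t < b).
  { intros t. unfold Rmin, Rmax. destruct (Rle_dec x y); lra. }
  destruct (MVT_gen g x y (fun _ => 0)) as [z [_ Hz]].
  - intros t Ht. apply Hg, Hin. lra.
  - intros t Ht. apply continuity_pt_filterlim.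
    apply (ex_derive_continuous g). exists 0. apply Hg, Hin, Ht.
  - lra.
Qed.

(** Integrating factor: [(q t - lambda / mu) * exp (mu * (t - a))] has zero derivative on the open
    interval, hence is constant there. Right-continuity at [a] then identifies the constant and adds
    the left endpoint. *)
Lemma linear_ode_solution (lambda mu a b : R) (q : R -> R) :
  0 < mu -> a < b ->
  (forall t, a < t < b -> is_derive q t (lambda - mu * q t)) ->
  filterlim q (at_right a) (locally (q a)) ->
  forall t, a <= t < b -> q t = relaxation lambda mu (q a - lambda / mu) (t - a).
Proof.
  intros Hmu Hab Hode Hra.
  set (g := fun t => (q t - lambda / mu) * exp (mu * (t - a))).
  assert (Hg : forall t, a < t < b -> is_derive g t 0).
  { intros t Ht. unfold g. specialize (Hode t Ht).
    auto_derive; [ eexists; exact Hode | ].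
    change (Derive (fun x => q x) t) with (Derive q t).
    rewrite (is_derive_unique _ _ _ Hode). field. lra. }
  (* The constant is first read off at an interior point, because the derivative is known only
     inside the interval. *)
  set (m := (a + b) / 2). assert (Hm : a < m < b) by (unfold m; lra).
  set (c := g m).
  assert (Hq : forall t, a < t < b -> q t = relaxation lambda mu c (t - a)).
  { intros t Ht. unfold relaxation, c.
    rewrite (zero_derivative_constant g a b Hg m t Hm Ht). unfold g.
    rewrite Rmult_assoc, <- exp_plus, Rplus_opp_r, exp_0. ring. }
  assert (Hqa : q a = relaxation lambda mu c (a - a)).
  { apply (filterlim_locally_unique (F := at_right a) q); [ exact Hra | ].
    apply filterlim_ext_loc with (fun t => relaxation lambda mu c (t - a)).
    - apply (filter_imp (fun t => a < t < b)); [ | apply at_right_interval, Hab ].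
      intros t Ht. symmetry. apply Hq, Ht.
    - apply filterlim_relaxation; [ lra | apply filter_le_within ]. }
  assert (Hc : q a - lambda / mu = c).
  { rewrite Hqa. unfold relaxation. rewrite Rminus_diag, Rmult_0_r, Ropp_0, exp_0.
    ring. }
  intros t [Ht1 Ht2]. rewrite Hc. destruct Ht1 as [Ht1 | <-]; auto.
Qed.

Lemma not_impulse_time (delta t : R) (n : nat) : 0 < delta ->
  INR n * delta < t < (INR n + 1) * delta ->
  forall k : nat, t <> impulse_time delta k.
Proof.
  intros Hd Ht k ->. unfold impulse_time in Ht. destruct Ht as [H1 H2].
  apply Rmult_lt_reg_r, INR_lt in H1; [ | exact Hd ].
  apply Rmult_lt_reg_r in H2; [ | exact Hd ].
  rewrite <- S_INR in H2. apply INR_lt in H2. lia.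
Qed.

(** The equation on the first period leaves only [q 0] free; the jump at [delta], combined with
    [q delta = q 0], determines it. *)
Lemma steady_state_first_period (lambda mu delta b : R) (q : R -> R) :
  0 < mu -> 0 < delta -> (1 + b) * exp (- (mu * delta)) < 1 ->
  steady_state lambda mu delta b q ->
  forall t, 0 <= t < delta ->
    q t = relaxation lambda mu (steady_amplitude lambda mu delta b) t.
Proof.
  intros Hmu Hd Hst [[Hode Hpost Hjump] Hper].
  assert (H0 : impulse_time delta 0 = 0) by (unfold impulse_time; simpl; ring).
  assert (H1 : impulse_time delta 1 = delta) by (unfold impulse_time; simpl; ring).
  pose proof (Hpost 0%nat) as Hp0. rewrite H0 in Hp0.
  pose proof (Hpost 1%nat) as Hp1. rewrite H1 in Hp1.
  pose proof (Hjump 1%nat (le_n _)) as Hj. rewrite H1 in Hj.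
  assert (Hq : forall t, 0 <= t < delta ->
    q t = relaxation lambda mu (q 0 - lambda / mu) (t - 0)).
  { apply linear_ode_solution; trivial. intros t Ht. apply Hode; [ lra | ].
    apply not_impulse_time with 0%nat; simpl; lra. }
  assert (Hamp : q 0 - lambda / mu = steady_amplitude lambda mu delta b).
  { destruct Hj as [qm [qp [Hm [Hp Hb]]]].
    (* The right limit at [delta] is [q delta] by right-continuity, and this is [q 0] by
       periodicity. *)
    assert (Eqp : qp = q 0).
    { rewrite <- (Hper 0 (Rle_refl 0)), Rplus_0_l.
      exact (filterlim_locally_unique q qp (q delta) Hp Hp1). }
    assert (Eqm : qm = relaxation lambda mu (q 0 - lambda / mu) (delta - 0)).
    { apply (filterlim_locally_unique (F := at_left delta) q); [ exact Hm | ].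
      apply filterlim_ext_loc
        with (fun t => relaxation lambda mu (q 0 - lambda / mu) (t - 0)).
      - apply (filter_imp (fun t => 0 < t < delta)); [ | apply at_left_interval, Hd ].
        intros t Ht. symmetry. apply Hq. lra.
      - apply filterlim_relaxation; [ lra | apply filter_le_within ]. }
    unfold relaxation in Eqm. rewrite Rminus_0_r in Eqm. unfold steady_amplitude.
    set (E := exp (- (mu * delta))) in *.
    (* Stability makes this factor positive, so the jump equation can be solved for the
       amplitude. *)
    apply Rmult_eq_reg_r with (1 - (1 + b) * E); [ | lra ].
    transitivity (b * (lambda / mu)); [ | field; lra ].
    assert (q 0 = (1 + b) * (lambda / mu + (q 0 - lambda / mu) * E))
      by (rewrite <- Eqm, <- Eqp; lra).
    lra. }
  intros t Ht. rewrite (Hq t Ht), Hamp, Rminus_0_r. reflexivity.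
Qed.

Lemma periodic_extension_eq (delta : R) (f : R -> R) (n : nat) (t : R) :
  0 < delta -> INR n * delta <= t < (INR n + 1) * delta ->
  periodic_extension delta f t = f (t - impulse_time delta n).
Proof.
  intros Hd Ht. unfold periodic_extension, impulse_time.
  replace (Int_part (t / delta)) with (Z.of_nat n).
  - rewrite <- INR_IZR_INZ. reflexivity.
  - apply Int_part_spec. rewrite <- INR_IZR_INZ. split.
    + apply Rmult_lt_reg_r with delta; [ exact Hd | ].
      replace ((t / delta - 1) * delta) with (t - delta) by (field; lra). lra.
    + apply Rmult_le_reg_r with delta; [ exact Hd | ].
      replace (t / delta * delta) with t by (field; lra). lra.
Qed.

Lemma nat_period (delta t : R) : 0 < delta -> 0 <= t ->
  exists n : nat, INR n * delta <= t < (INR n + 1) * delta.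
Proof.
  intros Hd Ht. destruct (nfloor_ex (t / delta)) as [n [H1 H2]].
  - apply Rdiv_le_0_compat; lra.
  - exists n. replace t with (t / delta * delta) by (field; lra). split.
    + apply Rmult_le_compat_r; lra.
    + apply Rmult_lt_compat_r; lra.
Qed.

(** Any [t >= 0] is carried back to the first period by finitely many shifts, all staying at
    nonnegative times, where periodicity is available. *)
Lemma periodic_extension_unique (delta : R) (f q : R -> R) : 0 < delta ->
  (forall t, 0 <= t -> q (t + delta) = q t) ->
  (forall t, 0 <= t < delta -> q t = f t) ->
  forall t, 0 <= t -> q t = periodic_extension delta f t.
Proof.
  intros Hd Hper Hf t Ht. destruct (nat_period delta t Hd Ht) as [n Hn].
  rewrite (periodic_extension_eq delta f n t Hd Hn). unfold impulse_time.
  rewrite <- Hf by lra.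
  assert (Hshift : forall k s, 0 <= s -> q (s + INR k * delta) = q s).
  { induction k as [ | k IH ]; intros s Hs.
    - simpl. f_equal. ring.
    - rewrite S_INR.
      replace (s + (INR k + 1) * delta) with ((s + delta) + INR k * delta) by ring.
      rewrite IH by lra. apply Hper, Hs. }
  rewrite <- (Hshift n (t - INR n * delta)) by lra. f_equal. ring.
Qed.

(** On each side of an impulse time the extension coincides with a shifted relaxation. Its one-sided
    limits are thus [f delta] and [f 0], and the amplitude is chosen so that
    [f 0 = (1 + b) * f delta]. *)
Lemma periodic_extension_steady_state (lambda mu delta b : R) :
  0 < mu -> 0 < delta -> (1 + b) * exp (- (mu * delta)) < 1 ->
  steady_state lambda mu delta b
    (periodic_extension delta
       (relaxation lambda mu (steady_amplitude lambda mu delta b))).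
Proof.
  intros Hmu Hd Hst.
  set (c := steady_amplitude lambda mu delta b).
  set (f := relaxation lambda mu c).
  assert (Hstart : forall n : nat,
    periodic_extension delta f (impulse_time delta n) = f 0).
  { intros n. rewrite (periodic_extension_eq delta f n) by (unfold impulse_time; lra).
    f_equal. ring. }
  assert (Hright : forall n : nat,
    filterlim (periodic_extension delta f) (at_right (impulse_time delta n))
      (locally (f 0))).
  { intros n. set (tn := impulse_time delta n).
    apply filterlim_ext_loc with (fun t => relaxation lambda mu c (t - tn)).
    - apply (filter_imp (fun t => tn < t < tn + delta));
      [ | apply at_right_interval; lra ].
      intros t Ht. symmetry. apply periodic_extension_eq; [ exact Hd | ].
      unfold tn, impulse_time in Ht. lra.
    - unfold f. rewrite <- (Rminus_diag tn).
      apply filterlim_relaxation; [ lra | apply filter_le_within ]. }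
  split; [ constructor | ].
  - intros t Ht Hk. destruct (nat_period delta t Hd) as [n Hn]; [ lra | ].
    (* Since [t] is not an impulse time, it is interior to its period, so a single shifted
       relaxation represents the extension near [t]. *)
    pose proof (Hk n) as Hkn. unfold impulse_time in Hkn.
    rewrite (periodic_extension_eq delta f n t Hd Hn).
    apply is_derive_ext_loc
      with (fun s => relaxation lambda mu c (s - impulse_time delta n)).
    + apply (filter_imp (fun s => INR n * delta < s < (INR n + 1) * delta));
      [ | apply (open_and _ _ (open_gt _) (open_lt _)); lra ].
      intros s Hs. symmetry. apply periodic_extension_eq; [ exact Hd | lra ].
    + apply is_derive_relaxation. lra.
  - intros k. rewrite Hstart. apply Hright.
  - intros [ | n ] Hk; [ lia | ].
    exists (f delta), (f 0). split; [ | split ].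
    (* Just before the impulse numbered [S n], the extension still follows the relaxation started at
       [tn]. *)
    + set (tn := impulse_time delta n).
      assert (Etn : impulse_time delta (S n) = tn + delta)
        by (unfold tn, impulse_time; rewrite S_INR; ring).
      rewrite Etn.
      apply filterlim_ext_loc with (fun t => relaxation lambda mu c (t - tn)).
      * apply (filter_imp (fun t => tn < t < tn + delta));
        [ | apply at_left_interval; lra ].
        intros t Ht. symmetry. apply periodic_extension_eq; [ exact Hd | ].
        unfold tn, impulse_time in Ht. lra.
      * unfold f. replace delta with (tn + delta - tn) at 2 by ring.
        apply filterlim_relaxation; [ lra | apply filter_le_within ].
    + apply Hright.
    + unfold f, relaxation, c, steady_amplitude.
      rewrite Rmult_0_r, Ropp_0, exp_0. field. split; lra.
  - intros t Ht. destruct (nat_period delta t Hd Ht) as [n Hn].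
    rewrite (periodic_extension_eq delta f n t Hd Hn).
    rewrite (periodic_extension_eq delta f (S n)) by (rewrite ?S_INR; lra).
    f_equal. unfold impulse_time. rewrite S_INR. ring.
Qed.

Lemma is_RInt_relaxation (lambda mu c delta : R) : mu <> 0 ->
  is_RInt (relaxation lambda mu c) 0 delta
    (lambda / mu * delta + c / mu * (1 - exp (- (mu * delta)))).
Proof.
  intros Hmu.
  set (F := fun t => lambda / mu * t - c / mu * exp (- (mu * t))).
  replace (lambda / mu * delta + c / mu * (1 - exp (- (mu * delta))))
    with (minus (F delta) (F 0)).
  - apply (is_RInt_derive F).
    + intros t _. unfold F, relaxation. auto_derive; trivial. field. exact Hmu.
    + intros t _. apply (ex_derive_continuous (relaxation lambda mu c)).
      unfold relaxation. auto_derive. trivial.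
  - unfold F, minus, plus, opp. simpl.
    rewrite !Rmult_0_r, Ropp_0, exp_0. ring.
Qed.

Theorem theorem2p4 (lambda mu delta b : R)
    (hlambda : 0 < lambda) (hmu : 0 < mu) (hdelta : 0 < delta) (hb : -1 < b)
    (hstable : (1 + b) * exp (- (mu * delta)) < 1) :
  (exists q : R -> R, steady_state lambda mu delta b q /\
     forall q' : R -> R, steady_state lambda mu delta b q' ->
       forall t : R, 0 <= t -> q' t = q t) /\
  (forall q : R -> R, steady_state lambda mu delta b q ->
     ex_RInt q 0 delta /\
     average_queue_length delta q =
       lambda / mu +
       (lambda * (1 + b) / (mu ^ 2 * delta) *
          ((1 - exp (- (mu * delta))) / (1 - (1 + b) * exp (- (mu * delta))))
        - lambda / (mu ^ 2 * delta)) *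
       (1 - exp (- (mu * delta)))).
Proof.
  split.
  - eexists. split; [ apply periodic_extension_steady_state; assumption | ].
    intros q' Hq'. apply periodic_extension_unique; [ assumption | apply Hq' | ].
    apply steady_state_first_period; assumption.
  - intros q Hq.
    assert (Hint : is_RInt q 0 delta
      (lambda / mu * delta + steady_amplitude lambda mu delta b / mu
         * (1 - exp (- (mu * delta))))).
    { apply is_RInt_ext
        with (relaxation lambda mu (steady_amplitude lambda mu delta b)).
      (* Agreement on the open interval suffices for the integral, so the post-impulse value of [q]
         at [delta] does no harm. *)
      - intros t. rewrite Rmin_left, Rmax_right by lra. intros Ht. symmetry.
        apply steady_state_first_period; trivial. lra.
      - apply is_RInt_relaxation. lra. }
    split; [ eexists; exact Hint | ].
    unfold average_queue_length. rewrite (is_RInt_unique _ _ _ _ Hint).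
    (* With [E = exp (- (mu * delta))], the two forms agree because [(1 + b) * (1 - E) - (1 - (1 +
       b) * E) = b]. *)
    unfold steady_amplitude. field. repeat split; lra.
Qed.
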